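(* Fix a vtree $v$. Compressed and trimmed VS-SDDs with respect to $v$ are canonical: for every Boolean function $f$ over the variables of $v$ there is exactly one compressed and trimmed VS-SDD $(\alpha,k)$ with $\langle\alpha,k\rangle=f$. Likewise, compressed, lightly trimmed, and normalized VS-SDDs with respect to $v$ are canonical.
   Context: A vtree over a set of variables is an ordered full binary tree whose leaves are in one-to-one correspondence with the variables; $l(x)$ denotes the variable of leaf $x$. Each vtree node $x$ has an integer ID $\mathtt{ID}(x)$ assigned by a preorder traversal; $\mathtt{ID}^{-1}(i)$ is the node with ID $i$. A node $y$ is a left (resp. right) descendant of $x$ if $y$ is a (not necessarily proper) descendant of the left (resp. right) child of $x$. For disjoint $\mathbf{X},\mathbf{Y}$, an $\mathbf{X}$-partition of $f(\mathbf{X},\mathbf{Y})$ is $f=\bigvee_{i=1}^n[p_i(\mathbf{X})\wedge s_i(\mathbf{Y})]$ with $p_i\wedge p_j=\mathit{false}$ ($i\ne j$), $\bigvee_i p_i=\mathit{true}$, $p_i\ne\mathit{false}$; compressed if the $s_i$ are pairwise distinct. A VS-SDD is a pair $(\alpha,k)$ of a structure $\alpha$ (a node of a DAG) and integer offset $k$, with semantics $\langle\alpha,k\rangle$: (constant) $\alpha=\top$ or $\bot$, $\langle\top,\cdot\rangle=\mathit{true}$, $\langle\bot,\cdot\rangle=\mathit{false}$; (literal) $\alpha=\mathbf{v}$ or $\neg\mathbf{v}$ where $\mathtt{ID}^{-1}(k)$ is a leaf, $\langle\mathbf{v},k\rangle=l(\mathtt{ID}^{-1}(k))$, $\langle\neg\mathbf{v},k\rangle=\neg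 l(\mathtt{ID}^{-1}(k))$; (decomposition) $\alpha=\{([p_1,d_1],[s_1,e_1]),\ldots,([p_n,d_n],[s_n,e_n])\}$ with $\mathtt{ID}^{-1}(k)$ internal, $\mathtt{ID}^{-1}(d_i+k)$ a left descendant and $\mathtt{ID}^{-1}(e_i+k)$ a right descendant of $\mathtt{ID}^{-1}(k)$, and $\langle p_i,d_i+k\rangle$ forming a partition; $\langle\alpha,k\rangle=\bigvee_i(\langle p_i,d_i+k\rangle\wedge\langle s_i,e_i+k\rangle)$. Identical structures are shared (considered equal) only when their offsets correspond to vtree nodes with isomorphic subtrees. A VS-SDD is compressed if each decomposition in it forms a compressed partition; trimmed if it has no decomposition of the form $\{([\top,\cdot],[\beta,d])\}$ or $\{([\beta,d],[\top,\cdot]),([\neg\beta,d],[\bot,\cdot])\}$; lightly trimmed if it has no decomposition of the form $\{([\top,\cdot],[\top,\cdot])\}$ or $\{([\top,\cdot],[\bot,\cdot])\}$; normalized if for every decomposition $(\beta,\ell)$ in it, every prime $[p_i,d_i]$ has $\mathtt{ID}^{-1}(d_i+\ell)$ equal to the left child of $\mathtt{ID}^{-1}(\ell)$ and every sub $[s_i,e_i]$ has $\mathtt{ID}^{-1}(e_i+\ell)$ equal to the right child of $\mathtt{ID}^{-1}(\ell)$.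
   Formalization: In the second claim a non-constant VS-SDD must have the root of v as its offset node; otherwise it is false: for leaves x, y and f = x, both (v,1) and ({([v,1],[⊤,·]),([¬v,1],[⊥,·])},0) qualify. Offsets of constants are ignored in comparing VS-SDDs. *)

(* Defs.v *)
From mathcomp Require Import all_boot all_order all_algebra.
From Stdlib Require List.

Set Implicit Arguments.
Unset Strict Implicit.
Unset Printing Implicit Defensive.

Local Open Scope ring_scope.

Inductive vtree (X : Type) : Type :=
| Leaf of X
| Node of vtree X & vtree X.

Fixpoint leaves (X : Type) (t : vtree X) : seq X :=
  match t with
  | Leaf x => [:: x]
  | Node l r => leaves l ++ leaves r
  end.

Definition vtree_over (X : finType) (t : vtree X) : Prop :=
  uniq (leaves t) /\ (forall x : X, x \in leaves t).

(* A node of a vtree is represented by the subtree rooted at it; this is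
   unambiguous as soon as the leaf labels are pairwise distinct. *)
Fixpoint preorder (X : Type) (t : vtree X) : seq (vtree X) :=
  t :: match t with
       | Leaf _ => [::]
       | Node l r => preorder l ++ preorder r
       end.

(* ID^{-1}: IDs number the nodes in preorder, and the root has ID 0. *)
Definition node_at (X : Type) (t : vtree X) (k : int) : option (vtree X) :=
  match k with
  | Posz n => onth (preorder t) n
  | Negz _ => None
  end.

Fixpoint descendant (X : Type) (y x : vtree X) : Prop :=
  y = x \/
  match x with
  | Leaf _ => False
  | Node l r => descendant y l \/ descendant y r
  end.

Definition bfun (X : finType) : finType := {ffun {ffun X -> bool} -> bool}.

Definition bfalse (X : finType) : bfun X := [ffun=> false].
Definition bneg (X : finType) (f : bfun X) : bfun X := [ffun a => ~~ f a].
Definition bdisj (X : finType) (f g : bfun X) : bool :=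
  [forall a, ~~ (f a && g a)].

Definition is_partition (X : finType) (ps : seq (bfun X)) : Prop :=
  [/\ pairwise (@bdisj X) ps,
      (forall a, has (fun p : bfun X => p a) ps)
    & bfalse X \notin ps].

(* Decompositions are finite sets, listed here in some order; they are compared
   as sets by [same_structure]. *)
Inductive structure : Type :=
| Top
| Bot
| Pos
| Neg
| Dec of seq ((structure * int) * (structure * int)).

Definition vssdd : Type := (structure * int)%type.

Definition is_const (s : structure) : bool :=
  match s with Top | Bot => true | _ => false end.

(* A decomposition element; its offsets are relative to that of the
   decomposition, and [shift k] makes them absolute. *)
Definition element : Type := (vssdd * vssdd)%type.
Definition shift (k : int) (A : vssdd) : vssdd := (A.1, A.2 + k).

(* Total evaluation; literals at an offset that is not the ID of a leaf, which
   [is_vssdd] excludes, get the dummy value false. *)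
Fixpoint eval (X : finType) (t : vtree X) (s : structure) (k : int)
    (a : {ffun X -> bool}) : bool :=
  match s with
  | Top => true
  | Bot => false
  | Pos => if node_at t k is Some (Leaf x) then a x else false
  | Neg => if node_at t k is Some (Leaf x) then ~~ a x else false
  | Dec es =>
      has (fun e => eval t e.1.1 (e.1.2 + k) a && eval t e.2.1 (e.2.2 + k) a) es
  end.

Definition denot (X : finType) (t : vtree X) (A : vssdd) : bfun X :=
  [ffun a => eval t A.1 A.2 a].

(* [inside B A]: the VS-SDD B (with absolute offset) occurs in A. *)
Inductive inside (B : vssdd) : vssdd -> Prop :=
| inside_refl : inside B B
| inside_prime (es : seq element) (k : int) (e : element) :
    List.In e es -> inside B (shift k e.1) -> inside B (Dec es, k)
| inside_sub (es : seq element) (k : int) (e : element) :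
    List.In e es -> inside B (shift k e.2) -> inside B (Dec es, k).

(* Constants are written [T, .] and [F, .]: their offset carries no information,
   hence is neither constrained here nor compared by [same_structure]. *)
Definition placed (X : Type) (t : vtree X) (Q : vtree X -> Prop) (A : vssdd)
    : Prop :=
  is_const A.1 \/ (exists y, node_at t A.2 = Some y /\ Q y).

Definition primes (X : finType) (t : vtree X) (es : seq element) (k : int)
    : seq (bfun X) := [seq denot t (shift k e.1) | e : element <- es].
Definition subs (X : finType) (t : vtree X) (es : seq element) (k : int)
    : seq (bfun X) := [seq denot t (shift k e.2) | e : element <- es].

Definition wf_dec (X : finType) (t : vtree X) (es : seq element) (k : int)
    : Prop :=
  exists l r : vtree X,
    [/\ node_at t k = Some (Node l r),
        (forall e, List.In e es ->
           placed t (fun y => descendant y l) (shift k e.1) /\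
           placed t (fun y => descendant y r) (shift k e.2))
      & is_partition (primes t es k)].

Definition is_vssdd (X : finType) (t : vtree X) (A : vssdd) : Prop :=
  forall B, inside B A ->
    match B.1 with
    | Top | Bot => True
    | Pos | Neg => exists x, node_at t B.2 = Some (Leaf x)
    | Dec es => wf_dec t es B.2
    end.

Definition compressed (X : finType) (t : vtree X) (A : vssdd) : Prop :=
  forall es k, inside (Dec es, k) A -> uniq (subs t es k).

(* {([T,.],[B,d])} *)
Definition trim1 (es : seq element) : Prop :=
  exists c (b : structure) d, es = [:: ((Top, c), (b, d))].

(* {([B,d],[T,.]),([~B,d],[F,.])}, in either order; ~B is a structure whose
   denotation at the same offset is the negation of that of B. *)
Definition trim2 (X : finType) (t : vtree X) (es : seq element) (k : int)
    : Prop :=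
  exists (b nb : structure) (d c c' : int),
    denot t (shift k (nb, d)) = bneg (denot t (shift k (b, d))) /\
    let e1 : element := ((b, d), (Top, c)) in
    let e2 : element := ((nb, d), (Bot, c')) in
    es = [:: e1; e2] \/ es = [:: e2; e1].

Definition trimmed (X : finType) (t : vtree X) (A : vssdd) : Prop :=
  forall es k, inside (Dec es, k) A -> ~ trim1 es /\ ~ trim2 t es k.

Definition lightly_trimmed (A : vssdd) : Prop :=
  forall es k, inside (Dec es, k) A ->
    ~ (exists c c', es = [:: ((Top, c), (Top, c'))]) /\
    ~ (exists c c', es = [:: ((Top, c), (Bot, c'))]).

Definition normalized (X : finType) (t : vtree X) (A : vssdd) : Prop :=
  forall es k, inside (Dec es, k) A ->
    exists l r : vtree X, node_at t k = Some (Node l r) /\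
      forall e, List.In e es ->
        placed t (fun y => y = l) (shift k e.1) /\
        placed t (fun y => y = r) (shift k e.2).

(* Normalization fixes the offsets of primes and subs but not that of the VS-SDD
   itself: [at_root] says that it is normalized for the whole vtree. *)
Definition at_root (X : finType) (t : vtree X) (A : vssdd) : Prop :=
  placed t (fun y => y = t) A.

(* Equality of structures, decompositions being compared as sets. *)
Fixpoint same_structure (s s' : structure) : bool :=
  match s, s' with
  | Top, Top | Bot, Bot | Pos, Pos | Neg, Neg => true
  | Dec es, Dec es' =>
      let same (e e' : element) :=
        [&& same_structure e.1.1 e'.1.1, is_const e.1.1 || (e.1.2 == e'.1.2),
            same_structure e.2.1 e'.2.1 & is_const e.2.1 || (e.2.2 == e'.2.2)] in
      all (fun e => has (fun e' => same e e') es') es &&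
      all (fun e' => has (fun e => same e e') es) es'
  | _, _ => false
  end.

(* Structures are identified only at vtree nodes with isomorphic subtrees; here
   both structures sit at the same offset, i.e. at the same vtree node. *)
Definition same_vssdd (A B : vssdd) : bool :=
  same_structure A.1 B.1 && (is_const A.1 || (A.2 == B.2)).

Definition canonical (X : finType) (t : vtree X) (P : vssdd -> Prop) : Prop :=
  forall f : bfun X,
    exists A, [/\ P A, denot t A = f
                & forall B, P B -> denot t B = f -> same_vssdd A B].

(* Main.v *)
Require Import Defs.
From mathcomp Require Import all_boot all_order all_algebra.
From mathcomp Require Import zify.
From Stdlib Require List.

(** A compressed partition of [f] along disjoint variable sets [V], [W] is unique:
    its subs are the cofactors of [f] with respect to the [V]-variables, and the
    prime of a sub is the set of [V]-assignments producing it.  So once the vtree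
    node of a VS-SDD is known to be determined by its denotation, uniqueness
    follows by induction on the vtree.  In the normalized case the node is imposed.
    In the trimmed case it is the lowest node above all variables that [f] depends
    on: if [f] ignored the variables on the right (left) of a decomposition node,
    its compressed partition would be [{(f, T), (~f, F)}] (resp. [{(T, f)}]), a
    shape that trimming forbids. *)

Set Implicit Arguments.
Unset Strict Implicit.
Unset Printing Implicit Defensive.

Local Open Scope ring_scope.

(** * List membership as a proposition, and boolean predicates *)

Lemma In_all (T : Type) (p : pred T) (s : seq T) :
  (forall x, List.In x s -> p x) -> all p s.
Proof.
elim: s => //= x s IHs p_s; rewrite p_s; last by left.
by apply: IHs => y s_y; apply: p_s; right.
Qed.

Lemma In_has (T : Type) (p : pred T) (s : seq T) (x : T) :
  List.In x s -> p x -> has p s.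
Proof. by elim: s => //= y s IHs [->|/IHs s_x] p_x; rewrite ?p_x ?s_x ?orbT. Qed.

Lemma eq_In_has (T : Type) (p q : pred T) (s : seq T) :
  (forall x, List.In x s -> p x = q x) -> has p s = has q s.
Proof.
elim: s => //= x s IHs pq; rewrite pq; last by left.
by rewrite IHs // => y s_y; apply: pq; right.
Qed.

Lemma In_map (T : Type) (U : eqType) (f : T -> U) (s : seq T) (x : T) :
  List.In x s -> f x \in map f s.
Proof. by elim: s => //= y s IHs [->|/IHs]; rewrite inE ?eqxx // => ->; rewrite orbT. Qed.

Lemma map_In (T : Type) (U : eqType) (f : T -> U) (s : seq T) (y : U) :
  y \in map f s -> exists2 x, List.In x s & f x = y.
Proof.
elim: s => //= x s IHs; rewrite inE => /orP[/eqP->|/IHs[z s_z <-]].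
  by exists x; first left.
by exists z; first right.
Qed.

(** * Variables and descendants in a vtree *)

Definition vars (X : finType) (y : vtree X) : {set X} := [set x in leaves y].

Lemma vars_Node (X : finType) (l r : vtree X) :
  vars (Node l r) = vars l :|: vars r.
Proof. by apply/setP => x; rewrite !inE mem_cat. Qed.

Lemma leaves_gt0 (X : Type) (y : vtree X) : (0 < size (leaves y))%N.
Proof. by elim: y => //= l IHl r IHr; rewrite size_cat addn_gt0 IHl. Qed.

Lemma vars_inhabited (X : finType) (y : vtree X) : exists x, x \in vars y.
Proof.
by have := leaves_gt0 y; case E: (leaves y) => [|x s] // _; exists x; rewrite !inE E mem_head.
Qed.

Lemma uniq_leaves_Node (X : finType) (l r : vtree X) :
  uniq (leaves (Node l r)) ->
  [/\ uniq (leaves l), uniq (leaves r) & [disjoint vars l & vars r]].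
Proof.
rewrite /= cat_uniq => /and3P[-> /hasPn lr ->]; split=> //.
rewrite disjoint_sym; apply/pred0P => x /=; rewrite !inE.
by apply/negbTE/nandP; case: (boolP (x \in leaves r)) => [/lr|]; [right|left].
Qed.

Lemma descendant_refl (X : Type) (y : vtree X) : descendant y y.
Proof. by case: y => *; left. Qed.

Lemma descendant_vars (X : finType) (y x : vtree X) :
  descendant y x -> vars y \subset vars x.
Proof.
elim: x => [x|l IHl r IHr] /= [->|] //; rewrite vars_Node.
case=> [/IHl|/IHr] sub; apply: (subset_trans sub); [exact: subsetUl|exact: subsetUr].
Qed.

Lemma descendant_size (X : Type) (y x : vtree X) :
  descendant y x -> (size (leaves y) <= size (leaves x))%N.
Proof.
elim: x => [x|l IHl r IHr] /= [->|] //; rewrite size_cat.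
case=> [/IHl|/IHr] le_y; apply: (leq_trans le_y); [exact: leq_addr|exact: leq_addl].
Qed.

Lemma descendant_uniq (X : finType) (y x : vtree X) :
  descendant y x -> uniq (leaves x) -> uniq (leaves y).
Proof.
elim: x => [x|l IHl r IHr] [->|] // desc_y /uniq_leaves_Node[Ul Ur _].
by case: desc_y => [/IHl|/IHr]; apply.
Qed.

(** * Preorder IDs *)

Lemma onth_preorder_descendant (X : Type) (t y : vtree X) (n : nat) :
  onth (preorder t) n = Some y -> descendant y t.
Proof.
elim: t n => [x|l IHl r IHr] [|n] /=.
- by case=> <-; left.
- by rewrite onth0n.
- by case=> <-; left.
- by rewrite onth_cat; case: ifP => _ /[dup] => [/IHl|/IHr]; right; [left|right].
Qed.

(** The preorder list of a subtree is a contiguous block headed by its root: the left child follows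
    its parent at once, and the right child follows the whole block of the left one. *)
Lemma onth_preorder_children (X : Type) (t l r : vtree X) (n : nat) :
  onth (preorder t) n = Some (Node l r) ->
  onth (preorder t) n.+1 = Some l /\
  onth (preorder t) (n + size (preorder l)).+1 = Some r.
Proof.
have onth0 (y : vtree X) : onth (preorder y) 0 = Some y by case: y.
have onth_lt (s : seq (vtree X)) m z : onth s m = Some z -> (m < size s)%N.
  by move=> sm; rewrite -onthTE sm.
have onthS (x : vtree X) s m : onth (x :: s) m.+1 = onth s m by [].
elim: t n => [x|l' IHl r' IHr] [|n]; rewrite [preorder _]/= !onthS ?onth0n //.
  case=> -> ->; rewrite !onth_cat add0n ltnn subnn onth0; split=> //.
  by case: (l).
rewrite !onth_cat; case: ifP => [_ /IHl[at_l at_r]|/negbT].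
  by rewrite !ifT //; [apply: onth_lt at_r|apply: onth_lt at_l].
rewrite -leqNgt => le_n /IHr[at_l at_r]; rewrite !ifF; [|lia|lia].
by split; [rewrite -at_l|rewrite -at_r]; congr onth; lia.
Qed.

(** Nodes are represented by subtrees, so equal subtrees at two positions must be ruled out. A root
    has more leaves than its proper descendants, and a subtree occurring in both children would give
    them a common variable. *)
Lemma onth_preorder_inj (X : finType) (t y : vtree X) (n m : nat) :
  uniq (leaves t) -> onth (preorder t) n = Some y ->
  onth (preorder t) m = Some y -> n = m.
Proof.
have irrefl (l r : vtree X) : ~ (descendant (Node l r) l \/ descendant (Node l r) r).
  by case=> /descendant_size; rewrite /= size_cat; have := leaves_gt0 l; have := leaves_gt0 r; lia.
have childN (l r z : vtree X) i : onth (preorder l ++ preorder r) i = Some z ->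
    descendant z l \/ descendant z r.
  by rewrite onth_cat; case: ifP => _ /onth_preorder_descendant; [left|right].
elim: t n m => [x|l IHl r IHr] [|n] [|m] // Ut; rewrite [preorder _]/=.
- by rewrite [onth _ m.+1]/= onth0n.
- by rewrite [onth _ n.+1]/= onth0n.
- by rewrite [onth _ n.+1]/= onth0n.
- by case=> <- /childN /irrefl.
- by move=> /childN + [yE]; rewrite -yE => /irrefl.
have [Ul Ur /pred0P dis] := uniq_leaves_Node Ut.
have apart : descendant y l -> descendant y r -> False.
  move=> /descendant_vars/subsetP yl /descendant_vars/subsetP yr.
  by have [x y_x] := vars_inhabited y; have := dis x; rewrite /= yl ?yr.
rewrite /= !onth_cat; case: ifP => [_|/negbT]; case: ifP => [_|/negbT].
- by move=> yn ym; rewrite (IHl n m).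
- by move=> _ /onth_preorder_descendant yl /onth_preorder_descendant /(apart yl).
- by move=> _ /onth_preorder_descendant yr /onth_preorder_descendant /apart /(_ yr).
rewrite -!leqNgt => le_m le_n yn ym; congr _.+1.
by rewrite -(subnK le_n) -(subnK le_m) (IHr _ _ Ur yn ym).
Qed.

Lemma node_at_root (X : Type) (t : vtree X) : node_at t 0 = Some t.
Proof. by case: t. Qed.

Lemma node_at_descendant (X : Type) (t y : vtree X) (k : int) :
  node_at t k = Some y -> descendant y t.
Proof. by case: k => // n /onth_preorder_descendant. Qed.

Lemma node_at_children (X : Type) (t l r : vtree X) (k : int) :
  node_at t k = Some (Node l r) ->
  exists kl kr, node_at t kl = Some l /\ node_at t kr = Some r.
Proof.
case: k => // n /onth_preorder_children[at_l at_r].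
by exists (Posz n.+1), (Posz (n + size (preorder l)).+1).
Qed.

Lemma node_at_inj (X : finType) (t y : vtree X) (k k' : int) :
  uniq (leaves t) -> node_at t k = Some y -> node_at t k' = Some y -> k = k'.
Proof. by case: k k' => [n|n] [m|m] // Ut yn ym; rewrite (onth_preorder_inj Ut yn ym). Qed.

(** * Boolean functions and the variables they depend on *)

Definition bconst (X : finType) (c : bool) : bfun X := [ffun=> c].

Lemma bconst_inj (X : finType) : injective (@bconst X).
Proof. by move=> c d /ffunP/(_ [ffun=> true]); rewrite !ffunE. Qed.

Lemma bnegK (X : finType) : involutive (@bneg X).
Proof. by move=> f; apply/ffunP => a; rewrite !ffunE negbK. Qed.

Definition depends_only (X : finType) (V : {set X}) (f : bfun X) : bool :=
  [forall a : {ffun X -> bool}, forall b : {ffun X -> bool},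
    [forall x in V, a x == b x] ==> (f a == f b)].

Lemma depends_onlyP (X : finType) (V : {set X}) (f : bfun X) :
  reflect (forall a b : {ffun X -> bool}, {in V, a =1 b} -> f a = f b)
          (depends_only V f).
Proof.
apply: (iffP forallP) => dep a.
  by move=> b ab; apply/eqP; have /forallP/(_ b)/implyP := dep a; apply;
    apply/forall_inP => x /ab ->.
apply/forallP => b; apply/implyP => /forall_inP ab; apply/eqP; apply: dep => x Vx.
exact/eqP/ab.
Qed.

Lemma depends_only_const (X : finType) (V : {set X}) (c : bool) :
  depends_only V (bconst X c).
Proof. by apply/depends_onlyP => a b _; rewrite !ffunE. Qed.

Lemma depends_only_neg (X : finType) (V : {set X}) (f : bfun X) :
  depends_only V (bneg f) = depends_only V f.
Proof.
suff sub g : depends_only V g -> depends_only V (bneg g).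
  by apply/idP/idP => /sub; rewrite ?bnegK.
by move/depends_onlyP => dep; apply/depends_onlyP => a b /dep ab; rewrite !ffunE ab.
Qed.

Lemma depends_only_sub (X : finType) (V W : {set X}) (f : bfun X) :
  V \subset W -> depends_only V f -> depends_only W f.
Proof.
move=> /subsetP VW /depends_onlyP dep; apply/depends_onlyP => a b ab.
by apply: dep => x /VW /ab.
Qed.

Definition merge (X : finType) (V : {set X}) (a b : {ffun X -> bool}) :
    {ffun X -> bool} := [ffun x => if x \in V then a x else b x].

Lemma merge_in (X : finType) (V : {set X}) (a b : {ffun X -> bool}) :
  {in V, merge V a b =1 a}.
Proof. by move=> x Vx; rewrite ffunE Vx. Qed.

Lemma merge_out (X : finType) (V W : {set X}) (a b : {ffun X -> bool}) :
  [disjoint V & W] -> {in W, merge V a b =1 b}.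
Proof. by move=> dis x Wx; rewrite ffunE (disjointFl dis). Qed.

(** If [a] and [b] agree on [V :&: W], then [merge V a b] agrees with [a] on [V] and with [b] on
    [W], so it links [f a] to [f b]. *)
Lemma depends_onlyI (X : finType) (V W : {set X}) (f : bfun X) :
  depends_only V f -> depends_only W f -> depends_only (V :&: W) f.
Proof.
move=> /depends_onlyP depV /depends_onlyP depW; apply/depends_onlyP => a b ab.
rewrite -(depV (merge V a b) a); last exact: merge_in.
apply: depW => x Wx; rewrite ffunE; case: ifP => // Vx.
by rewrite ab // inE Vx.
Qed.

(** * Compressed partitions: uniqueness and existence *)

(* The pair [(p, s)] stands for the element with prime [p] and sub [s]; primes
   speak about [V] and subs about [W]. *)
Definition compressed_partition (X : finType) (V W : {set X})
    (L : seq (bfun X * bfun X)) (f : bfun X) : Prop :=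
  [/\ forall u, u \in L -> depends_only V u.1 /\ depends_only W u.2,
      is_partition (unzip1 L), uniq (unzip2 L)
    & forall a, f a = has (fun u : bfun X * bfun X => u.1 a && u.2 a) L].

Lemma bdisjP (X : finType) (f g : bfun X) :
  reflect (forall a, f a -> g a -> False) (bdisj f g).
Proof.
apply: (iffP forallP) => dis a; last by apply/negP => /andP[/dis].
by move=> fa ga; have := dis a; rewrite fa ga.
Qed.

(** The primes are pairwise disjoint, so at [a] no element other than [u] contributes to the
    disjunction. *)
Lemma partition_at (X : finType) (V W : {set X}) (L : seq (bfun X * bfun X))
    (f : bfun X) (u : bfun X * bfun X) (a : {ffun X -> bool}) :
  compressed_partition V W L f -> u \in L -> u.1 a -> f a = u.2 a.
Proof.
move=> [_ [pw _ _] _ ->] Lu ua.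
have bdisjC : symmetric (@bdisj X).
  by move=> g h; apply/bdisjP/bdisjP => dis b x y; apply: (dis b).
have same v : v \in L -> v.1 a -> u = v \/ bdisj u.1 v.1.
  move: Lu pw; rewrite {ua}/unzip1; elim: L => //= w L IHL.
  rewrite !inE => Lu /andP[/allP w_dis pw] Lv va.
  case/orP: Lu => [/eqP uw|Lu]; case/orP: Lv => [/eqP vw|Lv].
  - by left; rewrite uw vw.
  - by right; rewrite uw w_dis // map_f.
  - by right; rewrite vw bdisjC w_dis // map_f.
  - exact: IHL.
apply/hasP/idP => [[v Lv /andP[va v2]]|u2]; last by exists u; rewrite ?ua.
by case: (same v Lv va) => [->//|/bdisjP/(_ a ua va)].
Qed.

(* Fixing the [V]-variables to a model of [p] leaves the cofactor [s] of [f], so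
   the subs are the cofactors, and each prime is recovered from its sub. *)
Lemma compressed_partition_sub (X : finType) (V W : {set X})
    (L L' : seq (bfun X * bfun X)) (f : bfun X) :
  [disjoint V & W] -> compressed_partition V W L f ->
  compressed_partition V W L' f -> {subset L <= L'}.
Proof.
move=> dis cL cL' u Lu.
have cofactor M M' v v' a : compressed_partition V W M f ->
    compressed_partition V W M' f -> v \in M -> v' \in M' ->
    v.1 a -> v'.1 a -> v.2 = v'.2.
  move=> cM cM' Mv Mv' va v'a; apply/ffunP => b.
  have [dM _ _ _] := cM; have [dM' _ _ _] := cM'.
  have [/depends_onlyP dv1 /depends_onlyP dv2] := dM _ Mv.
  have [/depends_onlyP dv1' /depends_onlyP dv2'] := dM' _ Mv'.
  (* The assignment [merge V a b] satisfies both primes, as [a] does, and gives both subs their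
     values at [b]; both values are therefore that of [f] there. *)
  have mV := @merge_in X V a b; have mW := merge_out a b dis.
  rewrite -(dv2 _ _ mW) -(dv2' _ _ mW) -(partition_at cM Mv); last by rewrite (dv1 _ _ mV).
  by rewrite (partition_at cM' Mv') ?(dv1' _ _ mV).
have elem M a : compressed_partition V W M f -> exists2 v, v \in M & v.1 a.
  by move=> [_ [_ cov _] _ _]; have /hasP[p /mapP[v Mv ->] va] := cov a; exists v.
have same2 M v v' : compressed_partition V W M f -> v \in M -> v' \in M ->
    v.2 = v'.2 -> v = v'.
  move=> [_ _ + _]; elim: M => //= w M IHM /andP[/negP wM uM].
  rewrite !inE => /orP[/eqP->|Mv] /orP[/eqP->|Mv'] // vv'; last exact: IHM.
    by case: wM; rewrite vv' map_f.
  by case: wM; rewrite -vv' map_f.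
have [a ua] : exists a, u.1 a.
  have [_ [_ _ /negP not0] _ _] := cL.
  case: (pickP (fun a => u.1 a)) => [a|none]; first by exists a.
  case: not0; suff -> : bfalse X = u.1 by rewrite map_f.
  by apply/ffunP => a; rewrite ffunE none.
have [v L'v va] := elem L' a cL'.
have uv2 := cofactor _ _ _ _ _ cL cL' Lu L'v ua va.
suff -> : u = v by [].
case: u v Lu L'v ua va uv2 => [p s] [p' s'] /= Lu L'v ua va /= ss'.
(* Where one prime holds, the element of the other list that covers [b] has the same sub, and by
   compression it is the expected element. *)
congr (_, _) => //; apply/ffunP => b; apply/idP/idP => pb.
  have [w L'w wb] := elem L' b cL'.
  have ws := cofactor _ _ _ _ _ cL cL' Lu L'w pb wb.
  by move: wb; rewrite (same2 _ _ _ cL' L'w L'v) // -ws.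
have [w Lw wb] := elem L b cL.
have ws := cofactor _ _ _ _ _ cL cL' Lw L'v wb pb.
by move: wb; rewrite (same2 _ _ _ cL Lw Lu) // ws.
Qed.

Lemma compressed_partition_perm (X : finType) (V W : {set X})
    (L L' : seq (bfun X * bfun X)) (f : bfun X) :
  [disjoint V & W] -> compressed_partition V W L f ->
  compressed_partition V W L' f -> perm_eq L L'.
Proof.
move=> dis cL cL'; have [_ _ uL _] := cL; have [_ _ uL' _] := cL'.
apply: uniq_perm; [exact: map_uniq uL|exact: map_uniq uL'|].
by move=> u; apply/idP/idP; apply: compressed_partition_sub; eassumption.
Qed.

(** The subs are the distinct cofactors [cof a], and the prime of a cofactor collects the
    assignments that produce it. *)
Lemma compressed_partition_exists (X : finType) (V W : {set X}) (f : bfun X) :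
  depends_only (V :|: W) f -> exists L, compressed_partition V W L f.
Proof.
move=> /depends_onlyP dep.
pose cof a : bfun X := [ffun b => f (merge V a b)].
pose prime s : bfun X := [ffun a => cof a == s].
pose subs := undup [seq cof a | a : {ffun X -> bool}].
have cofs a : cof a \in subs by rewrite mem_undup; apply/mapP; exists a; rewrite ?mem_enum.
exists [seq (prime s, s) | s <- subs]; split.
- move=> _ /mapP[s subs_s ->] /=; split; apply/depends_onlyP => a b ab.
    rewrite !ffunE; congr (_ == s); apply/ffunP => c; rewrite !ffunE; congr (f _).
    by apply/ffunP => x; rewrite !ffunE; case: ifP => // /ab.
  move: subs_s; rewrite mem_undup => /mapP[c _ ->]; rewrite !ffunE.
  apply: dep => x; rewrite inE !ffunE => /orP[->//|/ab ->//].
- rewrite /unzip1 -map_comp; split.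
  + have : uniq subs by exact: undup_uniq.
    elim: (subs) => //= s r IHr /andP[s_r /IHr ->]; rewrite andbT.
    apply/allP => _ /mapP[s' r_s' ->]; apply/bdisjP => a.
    by rewrite !ffunE => /eqP-> /eqP ss'; move: s_r; rewrite ss' r_s'.
  + by move=> a; apply/hasP; exists (prime (cof a)); rewrite ?ffunE //; exact: map_f.
  + apply/negP => /mapP[s]; rewrite mem_undup => /mapP[a _ ->] /ffunP/(_ a).
    by rewrite !ffunE eqxx.
- by rewrite /unzip2 -map_comp map_id undup_uniq.
- move=> a; have cofa : f a = cof a a.
    by rewrite ffunE; congr (f _); apply/ffunP => x; rewrite ffunE if_same.
  apply/idP/hasP => [fa|[_ /mapP[s _ ->] /=]].
    by exists (prime (cof a), cof a); [exact: map_f|rewrite /= ffunE eqxx -cofa].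
  by rewrite ffunE cofa => /andP[/eqP->].
Qed.

(** By uniqueness, any decomposition of such an [f] has a single element, with a true prime. *)
Lemma compressed_partition_top (X : finType) (V W : {set X}) (f : bfun X) :
  depends_only W f -> compressed_partition V W [:: (bconst X true, f)] f.
Proof.
move=> dep; split=> //= [u||a]; last by rewrite ffunE orbF.
  by rewrite inE => /eqP->; rewrite depends_only_const.
split=> //= [a|]; first by rewrite ffunE.
by rewrite inE; apply/eqP => /(@bconst_inj X false true).
Qed.

(** Since [f] is not constant, neither [f] nor its negation is the false prime. By uniqueness, a
    decomposition of such an [f] has the semantic content of the pattern in [trim2]. *)
Lemma compressed_partition_bool (X : finType) (V W : {set X}) (f : bfun X) :
  depends_only V f -> (forall c, f <> bconst X c) ->
  compressed_partition V W
    [:: (f, bconst X true); (bneg f, bconst X false)] f.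
Proof.
move=> dep nc; split=> /= [u|||a].
- by rewrite !inE => /orP[]/eqP->; rewrite ?depends_only_neg !depends_only_const dep.
- split=> /=.
  + by rewrite !andbT; apply/bdisjP => a; rewrite ffunE => ->.
  + by move=> a; rewrite ffunE orbF orbN.
  + rewrite !inE negb_or; apply/andP; split; apply/eqP => e0.
      by apply: (nc false); rewrite -e0.
    by apply: (nc true); rewrite -[f]bnegK -e0; apply/ffunP => a; rewrite !ffunE.
- by rewrite inE andbT; apply/eqP => /bconst_inj.
- by rewrite !ffunE andbT andbF !orbF.
Qed.

(** * Properties of everything inside a VS-SDD *)

(** Well-formedness, compression, trimming and normalization all quantify over [inside]. As a single
    invariant of this form they are passed down to elements, and rebuilt from them, together. *)
Definition everywhere (R : vssdd -> Prop) (A : vssdd) : Prop :=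
  forall B, inside B A -> R B.

Lemma everywhere_here (R : vssdd -> Prop) (A : vssdd) : everywhere R A -> R A.
Proof. by apply; exact: inside_refl. Qed.

Lemma everywhere_atom (R : vssdd -> Prop) (A : vssdd) :
  (forall es, A.1 <> Dec es) -> R A -> everywhere R A.
Proof.
move=> atom RA B BA; case: BA atom RA => // es k e _ _ /(_ es); by case.
Qed.

Lemma everywhere_elements (R : vssdd -> Prop) (es : seq element) (k : int) :
  everywhere R (Dec es, k) -> forall e, List.In e es ->
  everywhere R (shift k e.1) /\ everywhere R (shift k e.2).
Proof.
move=> RA e es_e; split=> B insB; apply: RA.
  exact: inside_prime es_e insB.
exact: inside_sub es_e insB.
Qed.

Lemma everywhere_Dec (R : vssdd -> Prop) (es : seq element) (k : int) :
  R (Dec es, k) ->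
  (forall e, List.In e es ->
     everywhere R (shift k e.1) /\ everywhere R (shift k e.2)) ->
  everywhere R (Dec es, k).
Proof.
move=> RA Res B; move EA: (Dec es, k) => A insB; case: insB EA => [<- //||];
  by move=> es' k' e + insB [ess' kk']; rewrite -ess' -kk' in insB * => /Res[R1 R2]; auto.
Qed.

Definition node_ok (X : finType) (t : vtree X)
    (D : seq element -> int -> Prop) (B : vssdd) : Prop :=
  match B.1 with
  | Top | Bot => True
  | Pos | Neg => exists x, node_at t B.2 = Some (Leaf x)
  | Dec es => D es B.2
  end.

Lemma node_ok_sub (X : finType) (t : vtree X) (D D' : seq element -> int -> Prop)
    (A : vssdd) :
  (forall es k, D es k -> D' es k) ->
  everywhere (node_ok t D) A -> everywhere (node_ok t D') A.
Proof.
by move=> DD' DA B /DA; rewrite /node_ok; case: B.1 => // es /DD'.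
Qed.

Definition wf_compressed (X : finType) (t : vtree X) (es : seq element) (k : int)
    : Prop := wf_dec t es k /\ uniq (subs t es k).

Definition trimmed_dec (X : finType) (t : vtree X) (es : seq element) (k : int)
    : Prop :=
  wf_compressed t es k /\ (~ trim1 es /\ ~ trim2 t es k).

Definition normalized_dec (X : finType) (t : vtree X) (es : seq element) (k : int)
    : Prop :=
  [/\ wf_compressed t es k,
      ~ (exists c c', es = [:: ((Top, c), (Top, c'))]) /\
      ~ (exists c c', es = [:: ((Top, c), (Bot, c'))])
    & exists l r : vtree X, node_at t k = Some (Node l r) /\
      forall e, List.In e es ->
        placed t (fun y => y = l) (shift k e.1) /\
        placed t (fun y => y = r) (shift k e.2)].

Lemma everywhere_trimmedP (X : finType) (t : vtree X) (A : vssdd) :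
  everywhere (node_ok t (trimmed_dec t)) A <->
  [/\ is_vssdd t A, compressed t A & trimmed t A].
Proof.
split=> [ok|[wf cmp trm] B insB].
  split=> [|es k /ok[[]]|es k /ok[]] //.
  by apply: (node_ok_sub _ ok) => es k [[]].
have := wf B insB; rewrite /node_ok; case: B insB => -[||||es] k //= insB wfB.
by split; [split=> //; exact: cmp insB|exact: trm insB].
Qed.

Lemma everywhere_normalizedP (X : finType) (t : vtree X) (A : vssdd) :
  everywhere (node_ok t (normalized_dec t)) A <->
  [/\ is_vssdd t A, compressed t A, lightly_trimmed A & normalized t A].
Proof.
split=> [ok|[wf cmp trm nrm] B insB].
  split=> [|es k /ok[[]]|es k /ok[]|es k /ok[]] //.
  by apply: (node_ok_sub _ ok) => es k [[]].
have := wf B insB; rewrite /node_ok; case: B insB => -[||||es] k //= insB wfB.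
by split; [split=> //; exact: cmp insB|exact: trm insB|exact: nrm insB].
Qed.

Lemma placed_sub (X : Type) (t : vtree X) (Q Q' : vtree X -> Prop) (A : vssdd) :
  (forall y, Q y -> Q' y) -> placed t Q A -> placed t Q' A.
Proof. by move=> QQ' [|[y [At_y /QQ' Qy]]]; [left|right; exists y]. Qed.

(** The clause of [is_vssdd] at [A] itself already puts a non-constant [A] at some node of [t]. *)
Lemma placed_root (X : finType) (t : vtree X) (A : vssdd) :
  is_vssdd t A -> placed t (fun y => descendant y t) A.
Proof.
move=> /everywhere_here; rewrite /placed; case: A.1 => /= [||[x]|[x]|es].
- by left.
- by left.
- by move=> At_x; right; exists (Leaf x); split=> //; exact: node_at_descendant At_x.
- by move=> At_x; right; exists (Leaf x); split=> //; exact: node_at_descendant At_x.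
- by case=> l [r [At _ _]]; right; exists (Node l r); split=> //; exact: node_at_descendant At.
Qed.

(** * Denotations and their variables *)

Lemma denot_Top (X : finType) (t : vtree X) (k : int) :
  denot t (Top, k) = bconst X true.
Proof. by apply/ffunP => a; rewrite !ffunE. Qed.

Lemma denot_Bot (X : finType) (t : vtree X) (k : int) :
  denot t (Bot, k) = bconst X false.
Proof. by apply/ffunP => a; rewrite !ffunE. Qed.

Definition const_structure (c : bool) : structure := if c then Top else Bot.

Lemma denot_const (X : finType) (t : vtree X) (c : bool) (k : int) :
  denot t (const_structure c, k) = bconst X c.
Proof. by case: c; [exact: denot_Top|exact: denot_Bot]. Qed.

Lemma is_constP (s : structure) : is_const s -> exists c, s = const_structure c.
Proof. by case: s => // _; [exists true|exists false]. Qed.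

Definition sem (X : finType) (t : vtree X) (k : int) (e : element) :
  bfun X * bfun X := (denot t (shift k e.1), denot t (shift k e.2)).

Lemma denot_Dec (X : finType) (t : vtree X) (es : seq element) (k : int)
    (a : {ffun X -> bool}) :
  denot t (Dec es, k) a =
  has (fun u : bfun X * bfun X => u.1 a && u.2 a) (map (sem t k) es).
Proof. by rewrite ffunE has_map; apply: eq_has => e; rewrite /= !ffunE. Qed.

(** The induction is on the vtree node [y], not on the structure: the elements of a decomposition
    located at [y] lie below its two children, and a VS-SDD located strictly below [y] lies below
    one of them. *)
Lemma denot_depends_only (X : finType) (t y : vtree X) (A : vssdd) :
  is_vssdd t A -> placed t (fun z => descendant z y) A ->
  depends_only (vars y) (denot t A).
Proof.
elim: y A => [x|l IHl r IHr] A wfA.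
  case=> [/is_constP[c Ac]|].
    by rewrite [A]surjective_pairing Ac denot_const depends_only_const.
  case=> z [At [zx|//]]; rewrite {z}zx in At.
  have := everywhere_here wfA.
  case: A At wfA => -[||||es] k /= At _; rewrite ?denot_Top ?denot_Bot ?depends_only_const //.
  - by move=> _; apply/depends_onlyP => a b ab; rewrite !ffunE /= At ab // !inE.
  - by move=> _; apply/depends_onlyP => a b ab; rewrite !ffunE /= At ab // !inE.
  - by case=> l [r []]; rewrite At.
rewrite vars_Node; case=> [cst|[z [At [zy|zy]]]]; last 1 first.
- case: zy => zy; [have := IHl A wfA|have := IHr A wfA].
    by move=> dep; apply: depends_only_sub (subsetUl _ _) _; apply: dep; right; exists z.
  by move=> dep; apply: depends_only_sub (subsetUr _ _) _; apply: dep; right; exists z.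
- by have [c Ac] := is_constP cst; rewrite [A]surjective_pairing Ac denot_const depends_only_const.
rewrite {z}zy in At; have := everywhere_here wfA.
case: A At wfA => -[||||es] k /= At wfA; rewrite ?denot_Top ?denot_Bot ?depends_only_const //;
  try by case=> x; rewrite At.
case=> l' [r' []]; rewrite At => -[<- <-] plc _; apply/depends_onlyP => a b ab.
rewrite !denot_Dec !has_map; apply: eq_In_has => e es_e /=.
have [pl pr] := plc e es_e; have [wl wr] := everywhere_elements wfA es_e.
have /depends_onlyP/(_ a b) -> := IHl _ wl pl; last first.
  by move=> x Vx; apply: ab; rewrite inE Vx.
have /depends_onlyP/(_ a b) -> // := IHr _ wr pr.
by move=> x Vx; apply: ab; rewrite inE Vx orbT.
Qed.

Lemma wf_dec_partition (X : finType) (t : vtree X) (es : seq element) (k : int) :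
  is_vssdd t (Dec es, k) -> uniq (subs t es k) ->
  exists l r : vtree X,
    [/\ node_at t k = Some (Node l r),
        forall e, List.In e es ->
           placed t (fun y => descendant y l) (shift k e.1) /\
           placed t (fun y => descendant y r) (shift k e.2)
      & compressed_partition (vars l) (vars r) (map (sem t k) es)
          (denot t (Dec es, k))].
Proof.
move=> wfA Us; have [l [r [At plc part]]] := everywhere_here wfA.
exists l, r; split=> //; split=> [u|||a].
- move=> /map_In[e es_e <-]; have [pl pr] := plc e es_e.
  by have [wl wr] := everywhere_elements wfA es_e; split; apply: denot_depends_only.
- by rewrite /unzip1 -map_comp.
- by rewrite /unzip2 -map_comp.
- by rewrite denot_Dec.
Qed.

(** * The lowest node above the variables of a function *)

(* For [f] depending only on [vars z], [spans z f] says that [z] is the lowest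
   node above all variables that [f] depends on. *)
Definition spans (X : finType) (z : vtree X) (f : bfun X) : Prop :=
  forall V, depends_only V f ->
  match z with
  | Leaf x => is_true (x \in V)
  | Node l r => ~~ [disjoint vars l & V] /\ ~~ [disjoint vars r & V]
  end.

Lemma spans_meets (X : finType) (z : vtree X) (f : bfun X) (V : {set X}) :
  spans z f -> depends_only V f -> ~~ [disjoint vars z & V].
Proof.
case: z => [x|l r] spz /spz => [Vx|[/pred0Pn[x /andP[lx Vx]] _]].
  by apply/pred0Pn; exists x; rewrite /= !inE eqxx.
by apply/pred0Pn; exists x; rewrite vars_Node; apply/andP; split=> //; apply/setUP; left.
Qed.

(** A constant depends on no variable at all, and the empty set meets nothing. *)
Lemma spans_nonconst (X : finType) (z : vtree X) (f : bfun X) (c : bool) :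
  spans z f -> f <> bconst X c.
Proof.
move=> spz fc; have := @spans_meets _ _ _ set0 spz.
by rewrite fc depends_only_const => /(_ isT)/pred0Pn[x /andP[_]]; rewrite /= in_set0.
Qed.

Lemma spans_neg (X : finType) (z : vtree X) (f : bfun X) :
  spans z (bneg f) -> spans z f.
Proof. by move=> spz V; rewrite -depends_only_neg => /spz. Qed.

(** If one node lies strictly below the other, [f] depends only on one child of the upper node,
    which therefore does not span [f]. If they lie in different branches, [f] depends only on a set
    disjoint from the variables of a node spanning it. *)
Lemma spans_inj (X : finType) (t z z' : vtree X) (f : bfun X) :
  uniq (leaves t) -> descendant z t -> descendant z' t ->
  spans z f -> depends_only (vars z) f ->
  spans z' f -> depends_only (vars z') f -> z = z'.
Proof.
move=> + + + spz dz spz' dz'; elim: t => [x|l IHl r IHr].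
  by move=> _ [->|//] [->|//].
move=> /uniq_leaves_Node[Ul Ur dis].
have away (V W : {set X}) (y : vtree X) : [disjoint V & W] -> vars y \subset V ->
    ~~ [disjoint W & vars y] -> False.
  by rewrite disjoint_sym => VW yV /negP; apply; apply: disjointWr VW.
have dis' : [disjoint vars r & vars l] by rewrite disjoint_sym.
case=> [zt|[zl|zr]] [zt'|[zl'|zr']].
- by rewrite zt zt'.
- by rewrite zt in spz; have [_ /(away _ _ _ dis)[]] := spz _ dz'; exact: descendant_vars.
- by rewrite zt in spz; have [/(away _ _ _ dis')[]] := spz _ dz'; exact: descendant_vars.
- by rewrite zt' in spz'; have [_ /(away _ _ _ dis)[]] := spz' _ dz; exact: descendant_vars.
- exact: IHl.
- case/negP: (spans_meets spz dz'); apply: disjointWl (descendant_vars zl) _.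
  exact: disjointWr (descendant_vars zr') dis.
- by rewrite zt' in spz'; have [/(away _ _ _ dis')[]] := spz' _ dz; exact: descendant_vars.
- case/negP: (spans_meets spz dz'); apply: disjointWl (descendant_vars zr) _.
  exact: disjointWr (descendant_vars zl') dis'.
- exact: IHr.
Qed.

(** * Matching and realizing decompositions *)

Lemma map_perm_eq1 (T : Type) (U : eqType) (f : T -> U) (s : seq T) (u : U) :
  perm_eq (map f s) [:: u] -> exists2 x, s = [:: x] & f x = u.
Proof.
move=> /perm_small_eq-/(_ isT); case: s => [|x [|y s]] //= [fx].
by exists x.
Qed.

(** Partitions are unique up to order only; the two cases become the two orders allowed in
    [trim2]. *)
Lemma map_perm_eq2 (T : Type) (U : eqType) (f : T -> U) (s : seq T) (u v : U) :
  perm_eq (map f s) [:: u; v] ->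
  exists x y, [/\ s = [:: x; y] \/ s = [:: y; x], f x = u & f y = v].
Proof.
move=> p; have := perm_size p; case: s p => [|x [|y [|z s]]] //= p _.
have := perm_mem p (f x); rewrite !inE eqxx => /esym/orP[]/eqP fx.
  move: p; rewrite fx perm_cons => /perm_small_eq-/(_ isT)[fy].
  by exists x, y; split=> //; left.
have := perm_trans p (permEl (perm_catC [:: u] [:: v])); rewrite fx perm_cons =>
  /perm_small_eq-/(_ isT)[fy].
by exists y, x; split=> //; right.
Qed.

(** This is the inductive step of both uniqueness proofs. Both lists realize the same partition, so
    each element has a counterpart with the same prime and sub functions; the last hypothesis turns
    this into equality of structures, and cancelling [k] gives equal relative offsets. *)
Lemma same_Dec (X : finType) (t : vtree X) (V W : {set X})
    (es es' : seq element) (k : int) (f : bfun X) :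
  [disjoint V & W] ->
  compressed_partition V W (map (sem t k) es) f ->
  compressed_partition V W (map (sem t k) es') f ->
  (forall e e', List.In e es -> List.In e' es' ->
     (denot t (shift k e.1) = denot t (shift k e'.1) ->
      same_vssdd (shift k e.1) (shift k e'.1)) /\
     (denot t (shift k e.2) = denot t (shift k e'.2) ->
      same_vssdd (shift k e.2) (shift k e'.2))) ->
  same_structure (Dec es) (Dec es').
Proof.
move=> dis cL cL' same.
have sub := compressed_partition_sub dis cL cL'.
have sub' := compressed_partition_sub dis cL' cL.
have same_elt e e' : List.In e es -> List.In e' es' -> sem t k e = sem t k e' ->
    [&& same_structure e.1.1 e'.1.1, is_const e.1.1 || (e.1.2 == e'.1.2),
        same_structure e.2.1 e'.2.1 & is_const e.2.1 || (e.2.2 == e'.2.2)].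
  move=> es_e es_e' [d1 d2]; 
  have [/(_ d1)/andP[-> c1] /(_ d2)/andP[-> c2]] := same e e' es_e es_e'.
  move: c1 c2; rewrite /shift /= => /orP[->|/eqP/GRing.addIr->] /orP[->|/eqP/GRing.addIr->];
    by rewrite ?eqxx ?orbT.
apply/andP; split; apply: In_all => e es_e.
  have /map_In[e' es_e' ee'] := sub _ (In_map (sem t k) es_e).
  by apply: (In_has es_e'); apply: same_elt.
have /map_In[e' es_e' ee'] := sub' _ (In_map (sem t k) es_e).
by apply: (In_has es_e'); apply: same_elt.
Qed.

Lemma same_vssdd_const (c : bool) (A B : vssdd) :
  A.1 = const_structure c -> B.1 = const_structure c -> same_vssdd A B.
Proof. by rewrite /same_vssdd => -> ->; case: c. Qed.

(** Subtracting [k] from absolute offsets makes them relative to the decomposition. *)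
Lemma realize_elements (X : finType) (t : vtree X) (P Q : vssdd -> Prop)
    (L : seq (bfun X * bfun X)) (k : int) :
  (forall u, u \in L -> (exists2 A, P A & denot t A = u.1) /\
                        (exists2 A, Q A & denot t A = u.2)) ->
  exists2 es : seq element, map (sem t k) es = L &
    forall e, List.In e es -> P (shift k e.1) /\ Q (shift k e.2).
Proof.
have shiftK (A : vssdd) : shift k (A.1, A.2 - k) = A.
  by rewrite /shift /= GRing.subrK -surjective_pairing.
elim: L => [|[p s] L IHL] LP; first by exists [::].
have [|es esL esP] := IHL; first by move=> u Lu; apply: LP; rewrite inE Lu orbT.
have [[A PA dA] [B QB dB]] := LP _ (mem_head _ _).
exists (((A.1, A.2 - k), (B.1, B.2 - k)) :: es); first by rewrite /= esL /sem !shiftK dA dB.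
by move=> e /= [<-|/esP//]; rewrite !shiftK.
Qed.

(** A function of one variable is determined by two values, which leaves the two constants and the
    two literals. *)
Lemma literal_or_const (X : finType) (t : vtree X) (x : X) (k : int) (f : bfun X) :
  node_at t k = Some (Leaf x) -> depends_only (vars (Leaf x)) f ->
  exists2 A : vssdd, denot t A = f &
    [\/ exists c, A = (const_structure c, k), A = (Pos, k) | A = (Neg, k)].
Proof.
move=> At /depends_onlyP dep.
pose at_x c : {ffun X -> bool} := [ffun=> c].
have fE a : f a = f (at_x (a x)).
  by apply: dep => z; rewrite !inE => /eqP->; rewrite ffunE.
case f1: (f (at_x true)); case f0: (f (at_x false)).
- exists (const_structure true, k); last by constructor; exists true.
  by apply/ffunP => a; rewrite denot_const ffunE fE; case: (a x).
- exists (Pos, k); last by constructor.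
  by apply/ffunP => a; rewrite !ffunE /= At fE; case: (a x).
- exists (Neg, k); last by constructor.
  by apply/ffunP => a; rewrite !ffunE /= At fE; case: (a x).
- exists (const_structure false, k); last by constructor; exists false.
  by apply/ffunP => a; rewrite denot_const ffunE fE; case: (a x).
Qed.

(** * Compressed and trimmed VS-SDDs *)

Definition trimmed_vssdd (X : finType) (t : vtree X) : vssdd -> Prop :=
  everywhere (node_ok t (trimmed_dec t)).

Lemma trimmed_is_vssdd (X : finType) (t : vtree X) (A : vssdd) :
  trimmed_vssdd t A -> is_vssdd t A.
Proof. by move/everywhere_trimmedP => []. Qed.

(** This makes the node of a non-constant trimmed VS-SDD a function of its denotation. The induction
    is on a node [y] above that of [A], since primes and subs may lie anywhere below the
    children. *)
Lemma trimmed_spans (X : finType) (t y z : vtree X) (A : vssdd) :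
  uniq (leaves t) -> trimmed_vssdd t A -> ~~ is_const A.1 ->
  node_at t A.2 = Some z -> descendant z y -> spans z (denot t A).
Proof.
move=> Ut; elim: y z A => [x|l IHl r IHr] z A okA ncA At.
  case=> // zx; rewrite {z}zx in At *; move: okA ncA At.
  (* These assignments differ only at [x], so a literal on [x] separates them, while any [V]
     avoiding [x] does not. *)
  pose a1 : {ffun X -> bool} := [ffun=> true].
  pose a0 : {ffun X -> bool} := [ffun z => z != x].
  have agree (V : {set X}) : x \notin V -> {in V, a1 =1 a0}.
    by move=> Vx z Vz; rewrite !ffunE; symmetry; apply: contraNneq Vx => <-.
  case: A => -[||||es] k okA //= _ At; last first.
  - by have [[[l [r []]]]] := everywhere_here okA; rewrite At.
  - move=> V /depends_onlyP dep; apply: contraT => /agree/dep.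
    by rewrite !ffunE /= At !ffunE eqxx.
  - move=> V /depends_onlyP dep; apply: contraT => /agree/dep.
    by rewrite !ffunE /= At !ffunE eqxx.
case=> [zy|[zl|zr]]; [|exact: IHl zl|exact: IHr zr].
rewrite {z}zy in At *; move: okA ncA At.
case: A => -[||||es] k okA //= _ At.
- by have [x] := everywhere_here okA; rewrite /= At.
- by have [x] := everywhere_here okA; rewrite /= At.
have [[_ Us] [ntrim1 ntrim2]] := everywhere_here okA.
have [l' [r' []]] := wf_dec_partition (trimmed_is_vssdd okA) Us.
rewrite /= At => -[<- <-] plc cp.
set f := denot t _ in cp *.
have [_ _ dis] := uniq_leaves_Node (descendant_uniq (node_at_descendant At) Ut).
(* A non-constant child would span its node by the induction hypothesis, so its denotation could not
   be constant. *)
have child_const y B c : (forall z A, trimmed_vssdd t A -> ~~ is_const A.1 ->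
      node_at t A.2 = Some z -> descendant z y -> spans z (denot t A)) ->
    trimmed_vssdd t B -> placed t (fun z => descendant z y) B ->
    denot t B = bconst X c -> B.1 = const_structure c.
  move=> IH okB plB dB; have [cstB|ncB] := boolP (is_const B.1).
    have [d Bd] := is_constP cstB; rewrite Bd; congr const_structure.
    by apply: (@bconst_inj X); rewrite -dB [B]surjective_pairing Bd denot_const.
  case: plB => [cstB|[z [Bz zy]]]; first by rewrite cstB in ncB.
  by case: (spans_nonconst (IH z B okB ncB Bz zy) dB).
(* Otherwise uniqueness leaves a single element with a true prime, whose structure must be [Top]:
   this is [trim1]. *)
have dep_r : ~~ depends_only (vars r) f.
  apply/negP => /(compressed_partition_top (vars l)) /(compressed_partition_perm dis cp).
  case/map_perm_eq1 => -[[p d] s] ese [de _].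
  have es_e : List.In ((p, d), s) es by rewrite ese; left.
  have [okp _] := everywhere_elements okA es_e; have [plp _] := plc _ es_e.
  apply: ntrim1; rewrite ese (child_const l _ true IHl okp plp de : p = Top).
  by case: s {ese de es_e okp plp} => b d'; exists d, b, d'.
have ncf c : f <> bconst X c.
  by move=> fc; move: dep_r; rewrite fc depends_only_const.
(* Otherwise uniqueness leaves primes denoting [f] and its negation, with subs [Top] and [Bot]. For
   [trim2] it remains to see that the two primes share their offset. *)
have dep_l : ~~ depends_only (vars l) f.
  apply/negP => /(compressed_partition_bool (vars r)) /(_ ncf) /(compressed_partition_perm dis cp).
  case/map_perm_eq2 => -[[p d] [s c]] [[[p' d'] [s' c']] [ese [dp ds] [dp' ds']]].
  have es_e : List.In ((p, d), (s, c)) es by case: ese => ->; [left|right; left].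
  have es_e' : List.In ((p', d'), (s', c')) es by case: ese => ->; [right; left|left].
  have [okp oks] := everywhere_elements okA es_e; have [plp pls] := plc _ es_e.
  have [okp' oks'] := everywhere_elements okA es_e'; have [plp' pls'] := plc _ es_e'.
  have sT : s = Top := child_const r _ true IHr oks pls ds.
  have sB : s' = Bot := child_const r _ false IHr oks' pls' ds'.
  (* Negation changes neither the support nor the spanning node, so each prime sits at a node
     spanning [f]; [spans_inj] then identifies the two nodes. *)
  have pos q i : trimmed_vssdd t (shift k (q, i)) ->
      placed t (fun z => descendant z l) (shift k (q, i)) ->
      denot t (shift k (q, i)) = f \/ denot t (shift k (q, i)) = bneg f ->
      exists z, [/\ node_at t (i + k) = Some z, spans z f & depends_only (vars z) f].
    move=> okq plq dq; have ncq : ~~ is_const q.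
      apply/negP => /is_constP[b qb]; move: dq; rewrite qb denot_const.
      case=> [/esym/ncf//|nb]; apply: (ncf (~~ b)); rewrite -[f]bnegK -nb.
      by apply/ffunP => a; rewrite !ffunE.
    case: plq => [/= qc|[z [Az zl]]]; first by rewrite qc in ncq.
    exists z; split=> //.
      by have := IHl z _ okq ncq Az zl; case: dq => -> // /spans_neg.
    have := @denot_depends_only _ t z _ (trimmed_is_vssdd okq).
    case: dq => ->; rewrite ?depends_only_neg; apply; right; exists z; split=> //;
    exact: descendant_refl.
  have [z [Az spz dz]] := pos _ _ okp plp (or_introl dp).
  have [z' [Az' spz' dz']] := pos _ _ okp' plp' (or_intror dp').
  have zz' : z = z'.
    apply: (spans_inj Ut _ _ spz dz spz' dz'); 
      [exact: node_at_descendant Az|exact: node_at_descendant Az'].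
  have dd' : d = d'.
    by rewrite -zz' in Az'; apply: (GRing.addIr k); exact: node_at_inj Ut Az Az'.
  apply: ntrim2; exists p, p', d, c, c'; rewrite dd'.
  split; first by rewrite -{2}dd'; rewrite [LHS]dp' -dp dd'.
  by rewrite dd' sT sB in ese.
have depA : depends_only (vars (Node l r)) f.
  apply: denot_depends_only (trimmed_is_vssdd okA) _.
  by right; exists (Node l r); split=> //; exact: descendant_refl.
rewrite vars_Node in depA.
move=> V /(depends_onlyI depA); rewrite setIUl => depV.
split; [apply: contra dep_r|apply: contra dep_l] => disV;
  apply: depends_only_sub depV; rewrite -setI_eq0 in disV; rewrite (eqP disV).
  by rewrite set0U subsetIl.
by rewrite setU0 subsetIl.
Qed.

Lemma denot_literal_neq (X : finType) (t : vtree X) (x : X) (k : int) :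
  node_at t k = Some (Leaf x) -> denot t (Pos, k) <> denot t (Neg, k).
Proof. by move=> At /ffunP/(_ [ffun=> true]); rewrite !ffunE /= At ffunE. Qed.

Lemma denot_const_inj (X : finType) (t : vtree X) (A B : vssdd) :
  is_const A.1 -> is_const B.1 -> denot t A = denot t B -> same_vssdd A B.
Proof.
case: A B => [a i] [b j] /= /is_constP[c ->] /is_constP[d ->].
by rewrite !denot_const => /bconst_inj->; apply: same_vssdd_const.
Qed.

Lemma trimmed_located (X : finType) (t : vtree X) (Q : vtree X -> Prop) (A : vssdd) :
  uniq (leaves t) -> trimmed_vssdd t A -> placed t Q A -> ~~ is_const A.1 ->
  exists z, [/\ node_at t A.2 = Some z, Q z, spans z (denot t A)
              & depends_only (vars z) (denot t A)].
Proof.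
move=> Ut okA [cA ncA|[z [At Qz]] ncA]; first by rewrite cA in ncA.
exists z; split=> //; first exact: trimmed_spans (node_at_descendant At).
apply: denot_depends_only (trimmed_is_vssdd okA) _.
by right; exists z; split=> //; exact: descendant_refl.
Qed.

(** Non-constant [A] and [B] both sit at the node spanning their common denotation, hence at the
    same offset. If that node is strictly below [y], the induction hypothesis for a child applies to
    [A] and [B] themselves; if it is [y], their elements are matched. *)
Lemma trimmed_unique (X : finType) (t y : vtree X) (A B : vssdd) :
  uniq (leaves t) -> trimmed_vssdd t A -> trimmed_vssdd t B ->
  placed t (fun z => descendant z y) A -> placed t (fun z => descendant z y) B ->
  denot t A = denot t B -> same_vssdd A B.
Proof.
move=> Ut; elim: y A B => [x|l IHl r IHr] A B okA okB plA plB AB;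
  (have [cA|ncA] := boolP (is_const A.1); have [cB|ncB] := boolP (is_const B.1);
   first exact: denot_const_inj AB).
1,4: have [c Ac] := is_constP cA; have [z [_ _ spz _]] := trimmed_located Ut okB plB ncB;
  by case: (spans_nonconst (c := c) spz); rewrite -AB [A]surjective_pairing Ac denot_const.
1,3: have [c Bc] := is_constP cB; have [z [_ _ spz _]] := trimmed_located Ut okA plA ncA;
  by case: (spans_nonconst (c := c) spz); rewrite AB [B]surjective_pairing Bc denot_const.
all: have [z [Az zy spz dz]] := trimmed_located Ut okA plA ncA.
all: have [z' [Bz z'y spz' dz']] := trimmed_located Ut okB plB ncB.
all: rewrite AB in spz dz.
all: have zz' := spans_inj Ut (node_at_descendant Az) (node_at_descendant Bz) spz dz spz' dz'.
all: rewrite -{z'}zz' in Bz z'y spz' dz'.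
all: have kk := node_at_inj Ut Az Bz.
all: case: A B kk AB okA okB {plA plB} ncA ncB Az Bz {spz dz spz' dz'} => sA k [sB k'] /= <- {k'}.
all: move=> AB okA okB ncA ncB Az Bz; rewrite /same_vssdd /= eqxx orbT andbT.
  case: zy => // zx; rewrite {z}zx in Az Bz {z'y}.
  have dec es : ~ trimmed_vssdd t (Dec es, k).
    by move=> /everywhere_here[[[l [r []]]]]; rewrite /= Az.
  by case: sA sB ncA ncB AB okA okB => [||||es] [||||es'] //= _ _ AB okA okB;
    solve [case: (dec _ okA)|case: (dec _ okB)|case: (denot_literal_neq Az AB)
          |case: (denot_literal_neq Az (esym AB))].
case: zy => [zy|zy]; last first.
  have plc s y' : descendant z y' -> placed t (fun z => descendant z y') (s, k).
    by move=> zy'; right; exists z.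
  case: zy => /[dup]/(plc sA) plA /(plc sB) plB.
    by have /andP[] := IHl _ _ okA okB plA plB AB.
  by have /andP[] := IHr _ _ okA okB plA plB AB.
rewrite {z}zy in Az Bz {z'y}.
have lit s : s = Pos \/ s = Neg -> ~ trimmed_vssdd t (s, k).
  by case=> -> /everywhere_here[x]; rewrite Az.
case: sA ncA AB okA => // [||es] _ AB okA; try by case: (lit _ _ okA); auto.
case: sB ncB AB okB => // [||es'] _ AB okB; try by case: (lit _ _ okB); auto.
have [[_ Us] _] := everywhere_here okA; have [[_ Us'] _] := everywhere_here okB.
have [l1 [r1 []]] := wf_dec_partition (trimmed_is_vssdd okA) Us.
have [l2 [r2 []]] := wf_dec_partition (trimmed_is_vssdd okB) Us'.
rewrite Az => -[<- <-] plc' cp' -[<- <-] plc cp.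
have [_ _ dis] := uniq_leaves_Node (descendant_uniq (node_at_descendant Az) Ut).
rewrite AB in cp; apply: (same_Dec dis cp cp') => e e' es_e es_e'.
have [okp oks] := everywhere_elements okA es_e; have [plp pls] := plc _ es_e.
have [okp' oks'] := everywhere_elements okB es_e'; have [plp' pls'] := plc' _ es_e'.
by split; [apply: IHl|apply: IHr].
Qed.

(** A function depending on one side only is realized below that child. A decomposition is built at
    [y] only when both sides matter, which is what keeps it trimmed. *)
Lemma trimmed_exists (X : finType) (t y : vtree X) (k : int) (f : bfun X) :
  node_at t k = Some y -> depends_only (vars y) f ->
  exists2 A, trimmed_vssdd t A /\ placed t (fun z => descendant z y) A
    & denot t A = f.
Proof.
elim: y k f => [x|l IHl r IHr] k f At dep.
  have [A dA shape] := literal_or_const At dep; exists A => //.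
  case: shape => [[c ->]|->|->]; split.
  - by apply: everywhere_atom => [es|]; case: c.
  - by left; case: (c).
  - by apply: everywhere_atom => //; exists x.
  - by right; exists (Leaf x); split=> //; left.
  - by apply: everywhere_atom => //; exists x.
  - by right; exists (Leaf x); split=> //; left.
have [kl [kr [Al Ar]]] := node_at_children At.
have [dep_l|ndep_l] := boolP (depends_only (vars l) f).
  have [A [okA plA] dA] := IHl _ _ Al dep_l; exists A => //; split=> //.
  by apply: placed_sub plA => z zl; right; left.
have [dep_r|ndep_r] := boolP (depends_only (vars r) f).
  have [A [okA plA] dA] := IHr _ _ Ar dep_r; exists A => //; split=> //.
  by apply: placed_sub plA => z zr; right; right.
rewrite vars_Node in dep; have [L cp] := compressed_partition_exists dep.
have [depL part Us fE] := cp.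
have [|es esL esP] := @realize_elements X t
  (fun A => trimmed_vssdd t A /\ placed t (fun z => descendant z l) A)
  (fun A => trimmed_vssdd t A /\ placed t (fun z => descendant z r) A) L k.
  by move=> u /depL[dl dr]; split; [apply: IHl Al dl|apply: IHr Ar dr].
have dA : denot t (Dec es, k) = f by apply/ffunP => a; rewrite denot_Dec esL fE.
exists (Dec es, k) => //; split; last first.
  by right; exists (Node l r); split=> //; left.
apply: everywhere_Dec => [|e /esP[[okp _] [oks _]] //].
split; [split|split].
- exists l, r; split=> //; first by move=> e /esP[[_ plp] [_ pls]].
  by rewrite -esL /unzip1 -map_comp in part.
- by rewrite -esL /unzip2 -map_comp in Us.
(* Under [trim1] the decomposition denotes its only sub, a function of the right variables. *)
- case=> c [b [d ese]]; move: ndep_r; rewrite -dA; apply/negP; rewrite negbK.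
  have [//|_ dr] := depL (sem t k ((Top, c), (b, d))); first by rewrite -esL ese mem_head.
  suff -> : denot t (Dec es, k) = denot t (shift k (b, d)) by [].
  by apply/ffunP => a; rewrite denot_Dec ese /= denot_Top ffunE orbF.
(* Under [trim2] it denotes its prime paired with [Top], a function of the left variables. *)
case=> b [nb [d [c [c' [_ ese]]]]]; move: ndep_l; rewrite -dA; apply/negP; rewrite negbK.
have [//|dl _] := depL (sem t k ((b, d), (Top, c))).
  by rewrite -esL; case: ese => ->; rewrite !inE eqxx ?orbT.
suff -> : denot t (Dec es, k) = denot t (shift k (b, d)) by [].
by apply/ffunP => a; rewrite denot_Dec; case: ese => -> /=;
  rewrite !denot_Top !denot_Bot !ffunE andbT andbF ?orbF.
Qed.

(** * Compressed, lightly trimmed and normalized VS-SDDs *)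

Definition normalized_vssdd (X : finType) (t : vtree X) : vssdd -> Prop :=
  everywhere (node_ok t (normalized_dec t)).

Lemma normalized_is_vssdd (X : finType) (t : vtree X) (A : vssdd) :
  normalized_vssdd t A -> is_vssdd t A.
Proof. by move/everywhere_normalizedP => []. Qed.

Lemma normalized_dec_partition (X : finType) (t l r : vtree X) (es : seq element)
    (k : int) :
  normalized_vssdd t (Dec es, k) -> node_at t k = Some (Node l r) ->
  compressed_partition (vars l) (vars r) (map (sem t k) es) (denot t (Dec es, k)) /\
  forall e, List.In e es ->
    [/\ normalized_vssdd t (shift k e.1), normalized_vssdd t (shift k e.2),
        placed t (fun y => y = l) (shift k e.1)
      & placed t (fun y => y = r) (shift k e.2)].
Proof.
move=> okA At; have [[_ Us] _ [l1 [r1 []]]] := everywhere_here okA.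
have [l2 [r2 []]] := wf_dec_partition (normalized_is_vssdd okA) Us.
rewrite /= At => -[<- <-] _ cp -[<- <-] plc; split=> // e es_e.
by have [okp oks] := everywhere_elements okA es_e; have [plp pls] := plc e es_e.
Qed.

(** The compressed partition of a constant [c] is the single pair of true and [c]. By induction its
    prime and sub are the structures [Top] and [const_structure c], which is a shape that light
    trimming forbids. *)
Lemma normalized_const (X : finType) (t y : vtree X) (A : vssdd) (c : bool) :
  uniq (leaves t) -> normalized_vssdd t A -> placed t (fun z => z = y) A ->
  denot t A = bconst X c -> A.1 = const_structure c.
Proof.
move=> Ut; elim: y A c => [x|l IHl r IHr] A c okA plA dA;
  (have [cA|ncA] := boolP (is_const A.1);
   first by have [d Ad] := is_constP cA; rewrite Ad; congr const_structure;
     apply: (@bconst_inj X); rewrite -dA [A]surjective_pairing Ad denot_const).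
all: case: plA => [cA|[z [At zy]]]; [by rewrite cA in ncA|rewrite {z}zy in At].
all: case: A okA dA ncA At => -[||||es] k okA dA //= _ At.
(* A literal takes different values at the all-true and all-false assignments. *)
1,2: move/ffunP: dA => dA; have := dA [ffun=> true]; have := dA [ffun=> false];
  by rewrite !ffunE /= At !ffunE; case: (c).
1: by have [[[l [r []]]]] := everywhere_here okA; rewrite /= At.
1,2: by have [x] := everywhere_here okA; rewrite /= At.
have [cp els] := normalized_dec_partition okA At.
have [_ _ dis] := uniq_leaves_Node (descendant_uniq (node_at_descendant At) Ut).
rewrite dA in cp.
have := compressed_partition_perm dis cp
  (compressed_partition_top (vars l) (depends_only_const (vars r) c)).
case/map_perm_eq1 => -[[p d] [s d']] ese [dp ds].
have [|okp oks plp pls] := els ((p, d), (s, d')); first by rewrite ese; left.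
have pT : p = Top := IHl _ true okp plp dp.
have sc : s = const_structure c := IHr _ c oks pls ds.
have [_ [nT nB] _] := everywhere_here okA.
by case: c sc {dA cp ds} => sc; [case: nT|case: nB]; exists d, d'; rewrite ese pT sc.
Qed.

(** Normalization imposes the node [y] on non-constant structures, so no spanning argument is
    needed; [normalized_const] settles the constants. *)
Lemma normalized_unique (X : finType) (t y : vtree X) (A B : vssdd) :
  uniq (leaves t) -> normalized_vssdd t A -> normalized_vssdd t B ->
  placed t (fun z => z = y) A -> placed t (fun z => z = y) B ->
  denot t A = denot t B -> same_vssdd A B.
Proof.
move=> Ut; elim: y A B => [x|l IHl r IHr] A B okA okB plA plB AB;
  (have [cA|ncA] := boolP (is_const A.1);
   first by have [c Ac] := is_constP cA; apply: (same_vssdd_const Ac);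
     apply: (normalized_const Ut okB plB); rewrite -AB [A]surjective_pairing Ac denot_const);
  (have [cB|ncB] := boolP (is_const B.1);
   first by have [c Bc] := is_constP cB; apply: (same_vssdd_const _ Bc);
     apply: (normalized_const Ut okA plA); rewrite AB [B]surjective_pairing Bc denot_const).
all: case: plA => [cA|[z [Az zy]]]; [by rewrite cA in ncA|rewrite {z}zy in Az].
all: case: plB => [cB|[z [Bz zy]]]; [by rewrite cB in ncB|rewrite {z}zy in Bz].
all: have kk := node_at_inj Ut Az Bz.
all: case: A B kk AB okA okB ncA ncB Az Bz => sA k [sB k'] /= <- {k'}.
all: move=> AB okA okB ncA ncB Az _; rewrite /same_vssdd /= eqxx orbT andbT.
  have dec es : ~ normalized_vssdd t (Dec es, k).
    by move=> /everywhere_here[[[l [r []]]]]; rewrite /= Az.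
  by case: sA sB ncA ncB AB okA okB => [||||es] [||||es'] //= _ _ AB okA okB;
    solve [case: (dec _ okA)|case: (dec _ okB)|case: (denot_literal_neq Az AB)
          |case: (denot_literal_neq Az (esym AB))].
have lit s : s = Pos \/ s = Neg -> ~ normalized_vssdd t (s, k).
  by case=> -> /everywhere_here[x]; rewrite Az.
case: sA ncA AB okA => // [||es] _ AB okA; try by case: (lit _ _ okA); auto.
case: sB ncB AB okB => // [||es'] _ AB okB; try by case: (lit _ _ okB); auto.
have [cp els] := normalized_dec_partition okA Az.
have [cp' els'] := normalized_dec_partition okB Az.
have [_ _ dis] := uniq_leaves_Node (descendant_uniq (node_at_descendant Az) Ut).
rewrite AB in cp; apply: (same_Dec dis cp cp') => e e' /els[? ? ? ?] /els'[? ? ? ?].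
by split; [apply: IHl|apply: IHr].
Qed.

Lemma normalized_exists (X : finType) (t y : vtree X) (k : int) (f : bfun X) :
  node_at t k = Some y -> depends_only (vars y) f ->
  exists2 A, normalized_vssdd t A /\ placed t (fun z => z = y) A
    & denot t A = f.
Proof.
elim: y k f => [x|l IHl r IHr] k f At dep.
  have [A dA shape] := literal_or_const At dep; exists A => //.
  case: shape => [[c ->]|->|->]; split.
  - by apply: everywhere_atom => [es|]; case: c.
  - by left; case: (c).
  - by apply: everywhere_atom => //; exists x.
  - by right; exists (Leaf x).
  - by apply: everywhere_atom => //; exists x.
  - by right; exists (Leaf x).
have [kl [kr [Al Ar]]] := node_at_children At.
(* Constants are realized directly: decomposing one at [y] would produce a shape excluded by light
   trimming. *)
have [/existsP[c /eqP ->]|ncf] := boolP [exists c, f == bconst X c].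
  exists (const_structure c, k); last exact: denot_const.
  split; last by left; case: (c).
  by apply: everywhere_atom => [es|]; case: c.
rewrite vars_Node in dep; have [L cp] := compressed_partition_exists dep.
have [depL part Us fE] := cp.
have [|es esL esP] := @realize_elements X t
  (fun A => normalized_vssdd t A /\ placed t (fun z => z = l) A)
  (fun A => normalized_vssdd t A /\ placed t (fun z => z = r) A) L k.
  by move=> u /depL[dl dr]; split; [apply: IHl Al dl|apply: IHr Ar dr].
have dA : denot t (Dec es, k) = f by apply/ffunP => a; rewrite denot_Dec esL fE.
exists (Dec es, k) => //; split; last by right; exists (Node l r).
apply: everywhere_Dec => [|e /esP[[okp _] [oks _]] //].
have no_const c c1 c2 : es <> [:: ((Top, c1), (const_structure c, c2))].
  move=> ese; case/existsP: ncf; exists c; apply/eqP; rewrite -dA; apply/ffunP => a.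
  by rewrite denot_Dec ese /= denot_Top denot_const !ffunE orbF.
split.
- split; last by rewrite -esL /unzip2 -map_comp in Us.
  exists l, r; split=> //; last by rewrite -esL /unzip1 -map_comp in part.
  move=> e /esP[[_ plp] [_ pls]].
  split; [apply: placed_sub plp|apply: placed_sub pls] => z ->; exact: descendant_refl.
- by split=> -[c1 [c2]]; [exact: (no_const true)|exact: (no_const false)].
by exists l, r; split=> // e /esP[[_ plp] [_ pls]].
Qed.

(** * Canonicity of both classes *)

Theorem theorem3 (X : finType) (t : vtree X) (Ht : vtree_over t) :
  canonical t (fun A => [/\ is_vssdd t A, compressed t A & trimmed t A]) /\
  canonical t (fun A => [/\ is_vssdd t A /\ at_root t A, compressed t A,
                            lightly_trimmed A & normalized t A]).
Proof.
have [Ut all_vars] := Ht.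
have dep f : depends_only (vars t) f.
  apply/depends_onlyP => a b ab; congr (f _); apply/ffunP => x.
  by apply: ab; rewrite inE.
split=> f.
  have [A [okA plA] dA] := trimmed_exists (node_at_root t) (dep f).
  exists A; split=> //; first exact/everywhere_trimmedP.
  move=> B okB dB; have [wfB _ _] := okB.
  (* In the trimmed case being placed below the root is automatic; in the normalized case [at_root]
     supplies the placement. *)
  apply: (trimmed_unique Ut okA _ plA (placed_root wfB)); last by rewrite dA dB.
  exact/everywhere_trimmedP.
have [A [okA plA] dA] := normalized_exists (node_at_root t) (dep f).
exists A; split=> //; first by have [] := (everywhere_normalizedP t A).1 okA.
move=> B [[wfB plB] cB lB nB] dB.
apply: (normalized_unique Ut okA _ plA plB); last by rewrite dA dB.
exact/everywhere_normalizedP.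
Qed.
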